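(* For all integers $s\ge 3$ and $n\ge 3$, $r_3(K_s,P_n)\le f(s;n-2)$.
   Context: For a coloring $\chi$ of the pairs of $[N]=\{1,\dots,N\}$ with integer colors, a triple $u<v<w$ is non-increasing if either $\chi(u,v)=\chi(u,w)\ge\chi(v,w)$ or $\chi(u,v)\ge\chi(v,w)=\chi(u,w)$; a set $S\subset[N]$ is non-increasing if all its triples are. $f(s;q)$ denotes the minimum $N$ such that for every coloring of the pairs of $[N]$ with at most $q$ colors $\kappa_1<\dots<\kappa_q$ (integers), there is a set $S\subset[N]$ of size $s$ that is non-increasing. $r_3(K_s,P_n)$ is the minimum $N$ such that every red/blue coloring of the triples of $[N]$ contains either a red complete $3$-uniform hypergraph on $s$ vertices (i.e., $s$ vertices all of whose triples are red) or a blue monotone path on $n$ vertices, i.e., vertices $x_1<x_2<\dots<x_n$ in $[N]$ with every triple $\{x_i,x_{i+1},x_{i+2}\}$, $1\le i\le n-2$, blue. *)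

(* Defs.v *)
From mathcomp Require Import all_boot all_order all_algebra.
From mathcomp Require Import boolp.

Set Implicit Arguments.
Unset Strict Implicit.
Unset Printing Implicit Defensive.

(** The vertex set [N] is represented by 'I_N = {0, .., N-1} with its usual
    order. Colorings of pairs (triples) are functions on {set 'I_N}; only their
    values on sets of cardinality 2 (3) are ever used. *)

Definition chi2 (N : nat) (chi : {set 'I_N} -> int) (u v : 'I_N) : int :=
  chi [set u; v].

Definition nonincreasing_triple (N : nat) (chi : {set 'I_N} -> int)
    (u v w : 'I_N) : Prop :=
  (chi2 chi u v = chi2 chi u w /\ (chi2 chi u w >= chi2 chi v w)%R) \/
  ((chi2 chi u v >= chi2 chi v w)%R /\ chi2 chi v w = chi2 chi u w).

Definition nonincreasing_set (N : nat) (chi : {set 'I_N} -> int)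
    (S : {set 'I_N}) : Prop :=
  forall u v w : 'I_N, u \in S -> v \in S -> w \in S ->
    u < v -> v < w -> nonincreasing_triple chi u v w.

(** kappa lists the available colors in increasing order; not all of them need
    to be used by chi. *)
Definition f_arrow (s q N : nat) : Prop :=
  forall kappa : seq int, sorted <%R kappa -> size kappa = q ->
  forall chi : {set 'I_N} -> int,
    (forall e : {set 'I_N}, #|e| = 2 -> chi e \in kappa) ->
  exists S : {set 'I_N}, #|S| = s /\ nonincreasing_set chi S.

Inductive color := Red | Blue.

Definition red_clique (N : nat) (c : {set 'I_N} -> color) (s : nat) : Prop :=
  exists S : {set 'I_N}, #|S| = s /\
    forall T : {set 'I_N}, T \subset S -> #|T| = 3 -> c T = Red.

Definition blue_monotone_path (N : nat) (c : {set 'I_N} -> color) (n : nat) :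
    Prop :=
  exists x : 'I_n -> 'I_N,
    (forall i j : 'I_n, i < j -> x i < x j) /\
    (forall i j k : 'I_n, j = i.+1 :> nat -> k = i.+2 :> nat ->
      c [set x i; x j; x k] = Blue).

Definition r3_arrow (s n N : nat) : Prop :=
  forall c : {set 'I_N} -> color, red_clique c s \/ blue_monotone_path c n.

(** Finite Ramsey theorem, used only to show that the two minima exist. *)

Lemma ramsey (r q m : nat) : exists N : nat,
  forall (T : eqType) (L : seq T) (c : seq T -> 'I_q.+1),
    uniq L -> N <= size L ->
  exists (L' : seq T) (k : 'I_q.+1),
    [/\ subseq L' L, size L' = m &
        forall t, subseq t L' -> size t = r -> c t = k].
Proof.
elim: r m => [|r IHr] m.
  exists m => T L c _ sL; exists (take m L), (c [::]).
  split; [exact: take_subseq | exact: size_takel |].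
  by move=> t _ /size0nil->.
have pre k : exists N : nat,
  forall (T : eqType) (L : seq T) (c : seq T -> 'I_q.+1),
    uniq L -> N <= size L ->
  exists (L' : seq T) (g : T -> 'I_q.+1),
    [/\ subseq L' L, size L' = k &
        forall x t, subseq (x :: t) L' -> size t = r -> c (x :: t) = g x].
  elim: k => [|k [N IHk]].
    exists 0 => T L c _ _; exists [::], (fun=> ord0).
    by split=> //; exact: sub0seq.
  have [M HM] := IHr N; exists M.+1 => T [//|x L] c /= /andP[xL uL] sL.
  have [L1 [a [s1 z1 h1]]] := HM T L (fun t => c (x :: t)) uL sL.
  have u1 := subseq_uniq s1 uL.
  have [|L2 [g [s2 z2 h2]]] := IHk T L1 c u1; first by rewrite z1.
  exists (x :: L2), (fun y => if y == x then a else g y); split => /=.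
  - by rewrite eqxx (subseq_trans s2 s1).
  - by rewrite z2.
  move=> y t; case: (eqVneq y x) => [-> st zt|yx st zt].
    by apply: h1 => //; exact: subseq_trans st s2.
  exact: h2.
have [N HN] := pre (q.+1 * m); exists N => T L c uL sL.
have [L1 [g [s1 z1 h1]]] := HN T L c uL sL.
have [k Hk] : exists k, m <= count (fun x => g x == k) L1.
  apply: contrapT => nk.
  have lt k : count (fun x => g x == k) L1 < m.
    by rewrite ltnNge; apply/negP => mk; apply: nk; exists k.
  have m_gt0 : 0 < m by exact: leq_ltn_trans (lt ord0).
  have sumE : size L1 = \sum_(k < q.+1) count (fun x => g x == k) L1.
    elim: (L1) => [|y l IHl] /=; first by rewrite big1.
    rewrite big_split /= -IHl (bigD1 (g y)) //= eqxx big1 ?addn0 //.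
    by move=> i; rewrite eq_sym => /negPf->.
  have : size L1 <= \sum_(k < q.+1) m.-1.
    by rewrite sumE; apply: leq_sum => k _; rewrite -ltnS prednK.
  by rewrite z1 sum_nat_const card_ord leq_pmul2l // leqNgt prednK ?leqnn.
exists (take m [seq x <- L1 | g x == k]), k; split.
- apply: subseq_trans (take_subseq _ _) _.
  exact: subseq_trans (filter_subseq _ _) s1.
- by rewrite size_takel // size_filter.
move=> [//|x t] st [zt].
have st1 := subseq_trans st (take_subseq _ _).
rewrite (h1 x t) //; last exact: subseq_trans st1 (filter_subseq _ _).
have : x \in [seq x <- L1 | g x == k].
  by apply: (mem_subseq st1); rewrite inE eqxx.
by rewrite mem_filter => /andP[/eqP].
Qed.

Lemma sorted_enum_ord (N : nat) : sorted (fun u v : 'I_N => u < v) (enum 'I_N).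
Proof.
have := iota_ltn_sorted 0 N; rewrite -val_enum_ord sorted_map.
by apply: sub_sorted.
Qed.

Lemma ltord_trans (N : nat) : transitive (fun u v : 'I_N => u < v).
Proof. by move=> v u w; apply: ltn_trans. Qed.

Lemma sorted_subseq (N : nat) (t L : seq 'I_N) :
  sorted (fun u v : 'I_N => u < v) t -> sorted (fun u v : 'I_N => u < v) L ->
  {subset t <= L} -> subseq t L.
Proof.
move=> st sL tL.
have irr : irreflexive (fun u v : 'I_N => u < v) by move=> x; exact: ltnn.
have tr := @ltord_trans N.
have uL := sorted_uniq tr irr sL; have ut := sorted_uniq tr irr st.
suff -> : t = [seq x <- L | x \in t] by exact: filter_subseq.
apply: (irr_sorted_eq tr irr st) => [|x]; first exact: sorted_filter.
by rewrite mem_filter; case: (boolP (x \in t)) => // /tL ->.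
Qed.

Lemma f_arrow_ex (s q : nat) : exists N, f_arrow s q N.
Proof.
have [N HN] := ramsey 2 q s; exists N => kappa _ zk chi hchi.
pose c (t : seq 'I_N) : 'I_q.+1 := inord (index (chi [set x in t]) kappa).
have [|L [k [sL zL hL]]] := HN _ (enum 'I_N) c (enum_uniq _).
  by rewrite size_enum_ord.
have uL := subseq_uniq sL (enum_uniq _).
have srt : sorted (fun u v : 'I_N => u < v) L.
  exact: subseq_sorted (@ltord_trans N) _ _ sL (sorted_enum_ord N).
exists [set x in L]; split; first by rewrite cardsE (card_uniqP uL).
have col u v : u \in L -> v \in L -> u < v ->
    chi2 chi u v = nth 0%R kappa k.
  move=> uI vI uv; have neq : u != v by rewrite -val_eqE neq_ltn uv.
  have E : [set x in [:: u; v]] = [set u; v].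
    by apply/setP => x; rewrite !inE.
  have in_k : chi [set u; v] \in kappa by apply: hchi; rewrite cards2 neq.
  rewrite -(hL [:: u; v]) //.
    rewrite /c E inordK ?nth_index //.
    by rewrite ltnS -zk index_size.
  apply: sorted_subseq => //=; first by rewrite uv.
  by move=> x; rewrite !inE => /orP[]/eqP->.
move=> u v w; rewrite !inE => uI vI wI uv vw; left.
by rewrite !col // (ltn_trans uv).
Qed.

Lemma r3_arrow_ex (s n : nat) : exists N, r3_arrow s n N.
Proof.
have [N HN] := ramsey 3 1 (s + n); exists N => chi.
pose c (t : seq 'I_N) : 'I_2 := if chi [set x in t] is Red then ord0 else ord_max.
have [|L [k [sL zL hL]]] := HN _ (enum 'I_N) c (enum_uniq _).
  by rewrite size_enum_ord.
have uL := subseq_uniq sL (enum_uniq _).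
have srt : sorted (fun u v : 'I_N => u < v) L.
  exact: subseq_sorted (@ltord_trans N) _ _ sL (sorted_enum_ord N).
have [k0|k1] := eqVneq k ord0.
  left; exists [set x in take s L]; split.
    by rewrite cardsE (card_uniqP (take_uniq _ uL)) size_takel // zL leq_addr.
  move=> T sT zT.
  have stL : subseq (enum T) L.
    apply: sorted_subseq => //.
      rewrite {1}/enum_mem; apply: sorted_filter; first exact: ltord_trans.
      by have := sorted_enum_ord N; rewrite enumT.
    move=> x; rewrite mem_enum => /(subsetP sT); rewrite inE.
    exact: mem_take.
  have := hL _ stL; rewrite -cardE => /(_ zT); rewrite k0 /c.
  have -> : [set x in enum T] = T by apply/setP => x; rewrite inE mem_enum.
  by case: (chi T).
right; case: n zL {HN} => [|n] zL.
  by exists (fun i : 'I_0 => match notF (valP i) with end); split=> -[].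
have [x0 _] : exists x0 : 'I_N, true.
  by case: (L) zL => [|x0 ?]; [rewrite addnS | exists x0].
have szi (i : 'I_n.+1) : i < size L.
  by rewrite zL (leq_trans (ltn_ord i)) // leq_addl.
have mono (i j : 'I_n.+1) : i < j -> nth x0 L i < nth x0 L j.
  move=> ij; apply: (sorted_ltn_nth (@ltord_trans N) x0 srt) => //; exact: szi.
exists (fun i => nth x0 L i); split=> // i j l ij il.
set u := nth _ _ i; set v := nth _ _ j; set w := nth _ _ l.
have uv : u < v by apply: mono; rewrite ij.
have vw : v < w by apply: mono; rewrite ij il.
have E : [set x in [:: u; v; w]] = [set u; v; w].
  by apply/setP => x; rewrite !inE orbA.
have := hL [:: u; v; w]; rewrite /c E.
case: (chi _) => // /(_ _ erefl) H; case/eqP: k1; rewrite -H //.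
apply: sorted_subseq => //=; first by rewrite uv vw.
by move=> x; rewrite !inE => /or3P[]/eqP->; exact: mem_nth (szi _).
Qed.

Definition least (P : nat -> Prop) (exP : exists N, P N) : nat :=
  @ex_minn (fun N => `[< P N >])
    (let: ex_intro N PN := exP in ex_intro _ N (asboolT PN)).

Lemma leastP (P : nat -> Prop) (exP : exists N, P N) :
  P (least exP) /\ forall N, P N -> least exP <= N.
Proof.
by rewrite /least; case: ex_minnP => N /asboolP PN minN; split=> // M /asboolT/minN.
Qed.

Definition f (s q : nat) : nat := least (f_arrow_ex s q).

(** r3 s n is the Ramsey number r_3(K_s, P_n). *)
Definition r3 (s n : nat) : nat := least (r3_arrow_ex s n).

(* Main.v *)
Require Import Defs.
From mathcomp Require Import all_boot.
From mathcomp Require Import all_order all_algebra boolp zify.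

(** Given a coloring of triples without a blue monotone path on [n] vertices,
    color a pair [u < v] by the length of the longest blue monotone path whose
    last two vertices are [u] and [v]; this uses [n - 2] colors.  Appending [w]
    to a path ending in [u, v] shows that a blue triple [u < v < w] satisfies
    [chi u v < chi v w], so it is not non-increasing: every non-increasing set
    is a red clique. *)

Definition is_blue (a : color) : bool := if a is Blue then true else false.

Lemma is_blueP (a : color) : is_blue a -> a = Blue.
Proof. by case: a. Qed.

Section LongestBluePath.
Variables (N : nat) (c : {set 'I_N} -> color).

(* There is a blue monotone path on [k + 2] vertices ending in [u, v]. *)
Fixpoint blue_path_to (k : nat) (u v : 'I_N) : bool :=
  (u < v) && (if k is k'.+1 then
    [exists t : 'I_N, is_blue (c [set t; u; v]) && blue_path_to k' t u]
    else true).

Lemma blue_path_to_lt k u v : blue_path_to k u v -> u < v.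
Proof. by case: k => [|k] /= /andP[]. Qed.

Lemma blue_path_toS k (u v w : 'I_N) : blue_path_to k u v -> v < w ->
  c [set u; v; w] = Blue -> blue_path_to k.+1 v w.
Proof. by move=> p vw b /=; rewrite vw; apply/existsP; exists u; rewrite b. Qed.

(** Unwinds the recursion into a vertex sequence. Indexing by [nat] avoids ordinal casts; values
    beyond [k.+1] are irrelevant. *)
Lemma blue_path_to_seq k u v : blue_path_to k u v ->
  exists x : nat -> 'I_N,
    [/\ x k = u, x k.+1 = v,
        forall i j, i < j -> j <= k.+1 -> x i < x j &
        forall i, i < k -> c [set x i; x i.+1; x i.+2] = Blue].
Proof.
elim: k u v => [|k IHk] u v /=.
  rewrite andbT => uv; exists (fun i => if i is 0 then u else v).
  by split=> // -[|i] [|[|j]].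
case/andP=> uv /existsP[t /andP[/is_blueP b /IHk[x [xk xk1 mono blue]]]].
(* The path ending in [t, u] is kept and [v] is placed at index [k.+2]. *)
exists (fun i => if i <= k.+1 then x i else v); split.
- by rewrite leqnn.
- by rewrite ltnn.
- move=> i j ij jk; case: (leqP j k.+1) => jk1.
    by rewrite (leq_trans (ltnW ij) jk1) mono.
  have ik : i <= k.+1 by lia.
  rewrite ik; case: (ltngtP i k.+1) ik => // [ik _|-> _]; last by rewrite xk1.
  by apply: ltn_trans uv; rewrite -xk1 mono.
- move=> i ik1; have [ik|ki] := ltnP i k; last first.
    have -> : i = k by lia.
    by rewrite leqnSn leqnn ltnn xk xk1.
  have [-> [-> ->]] : i <= k.+1 /\ i < k.+1 /\ i.+1 < k.+1 by lia.
  exact: blue.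
Qed.

Lemma blue_path_to_monotone_path k u v :
  blue_path_to k u v -> blue_monotone_path c k.+2.
Proof.
case/blue_path_to_seq=> x [_ _ mono blue].
exists (fun i => x i); split=> [i j ij|i j l ij il].
  by apply: mono => //; rewrite -ltnS.
by rewrite ij il; apply: blue; have := ltn_ord l; lia.
Qed.

(* [height] does not depend on the order of the two vertices of the pair,
   because [blue_path_to] forces [u < v]. *)
Definition height (m : nat) (e : {set 'I_N}) : nat :=
  \max_(k < m | [exists u, exists v, (e == [set u; v]) && blue_path_to k u v]) k.

Lemma height_ltn m e : 0 < m -> height m e < m.
Proof.
by case: m => // m _; rewrite ltnS; apply/bigmax_leqP=> k _; rewrite -ltnS.
Qed.

Lemma leq_height m k u v : k < m -> blue_path_to k u v ->
  k <= height m [set u; v].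
Proof.
move=> km p.
rewrite /height (bigD1 (Ordinal km)) /= ?leq_maxl //.
by apply/existsP; exists u; apply/existsP; exists v; rewrite eqxx.
Qed.

(** Recovers the ordered pair from the unordered one that [height] takes as argument. *)
Lemma set2_ltn_inj (u v x y : 'I_N) : u < v -> x < y ->
  [set u; v] = [set x; y] -> u = x /\ v = y.
Proof.
move=> uv xy E.
have : u \in [set x; y] by rewrite -E set21.
have : v \in [set x; y] by rewrite -E set22.
rewrite !inE => /orP[]/eqP Ev /orP[]/eqP Eu; rewrite {}Ev {}Eu {E} in uv * => //.
- by rewrite ltnn in uv.
- by have := ltn_trans uv xy; rewrite ltnn.
- by rewrite ltnn in uv.
Qed.

Lemma height_path m (u v : 'I_N) : 0 < m -> u < v ->
  blue_path_to (height m [set u; v]) u v.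
Proof.
move=> m_gt0 uv.
pose P (k : 'I_m) :=
  [exists x, exists y, ([set u; v] == [set x; y]) && blue_path_to k x y].
(* Index [0] always qualifies, as [u < v] alone is a path on two vertices; hence the maximum is
   attained. *)
have P0 : P (Ordinal m_gt0).
  apply/existsP; exists u; apply/existsP; exists v.
  by rewrite eqxx /= andbT.
have [|k /existsP[x /existsP[y /andP[/eqP E p]]] Ek] :=
  eq_bigmax_cond (A := P) (fun k => nat_of_ord k).
  by apply/card_gt0P; exists (Ordinal m_gt0).
have -> : height m [set u; v] = k by exact: Ek.
by have [-> ->] := set2_ltn_inj _ _ _ _ uv (blue_path_to_lt _ _ _ p) E.
Qed.

Lemma height_blue m (u v w : 'I_N) : 0 < m -> ~ blue_monotone_path c m.+2 ->
  u < v -> v < w -> c [set u; v; w] = Blue ->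
  height m [set u; v] < height m [set v; w].
Proof.
move=> m_gt0 nopath uv vw b.
have p := blue_path_toS _ _ _ _ (height_path m u v m_gt0 uv) vw b.
(* The extended index must stay below [m]: if it equalled [m], the extended path would have [m.+2]
   vertices, against [nopath]. *)
apply: (leq_height _ _ _ _ _ p); rewrite ltn_neqAle height_ltn // andbT.
apply/eqP=> E; apply: nopath; move: p; rewrite E.
exact: blue_path_to_monotone_path.
Qed.

End LongestBluePath.

Lemma card3_sorted (N : nat) (T : {set 'I_N}) : #|T| = 3 ->
  exists u v w : 'I_N, [/\ u < v, v < w & T = [set u; v; w]].
Proof.
move=> T3.
have srt : sorted (fun u v : 'I_N => u < v) (enum T).
  rewrite {1}/enum_mem; apply: sorted_filter; first exact: ltord_trans.
  by have := sorted_enum_ord N; rewrite enumT.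
have mT := mem_enum T; move: T3; rewrite cardE.
case: (enum T) srt mT => [|u [|v [|w [|]]]] //= /and3P[uv vw _] mT _.
exists u, v, w; split=> //; apply/setP=> x.
by rewrite -[LHS]mT !inE orbA.
Qed.

Lemma nonincreasing_triple_ge (N : nat) (chi : {set 'I_N} -> int)
    (u v w : 'I_N) :
  nonincreasing_triple chi u v w -> (chi2 chi v w <= chi2 chi u v)%R.
Proof. by case=> [[-> ->]|[]]. Qed.

Lemma f_arrow_r3_arrow (s m N : nat) :
  0 < m -> f_arrow s m N -> r3_arrow s m.+2 N.
Proof.
move=> m_gt0 fN c.
have [path|nopath] := pselect (blue_monotone_path c m.+2); [by right | left].
(* The [m] colors are the possible heights [0, ..., m - 1], read as integers. *)
have [||e _|S [cardS niS]] := fN [seq Posz k | k <- iota 0 m] _ _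
  (fun e => Posz (height N c m e)).
- by rewrite sorted_map; exact: iota_ltn_sorted.
- by rewrite size_map size_iota.
- by apply: map_f; rewrite mem_iota add0n height_ltn.
exists S; split=> // T TS /card3_sorted[u [v [w [uv vw defT]]]].
move: TS; rewrite {}defT => /subsetP TS.
have [uS vS wS] : [/\ u \in S, v \in S & w \in S].
  by split; apply: TS; rewrite !inE eqxx ?orbT.
have := nonincreasing_triple_ge _ _ _ _ _ (niS u v w uS vS wS uv vw).
(* A blue triple would make the height strictly increase from [u, v] to [v, w]. *)
case b: (c _) => //; rewrite /chi2 lez_nat leqNgt.
by rewrite (height_blue _ _ _ _ _ _ m_gt0 nopath uv vw b).
Qed.

Theorem theorem2p2 (s n : nat) (hs : 3 <= s) (hn : 3 <= n) :
  r3 s n <= f s (n - 2).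
Proof.
have [fN _] := leastP (f_arrow_ex s (n - 2)).
have [_ minr3] := leastP (r3_arrow_ex s n).
have def_n : n = (n - 2).+2 by lia.
by apply: minr3; rewrite {1}def_n; apply: f_arrow_r3_arrow => //; lia.
Qed.
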